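(* Let $R$ be the root system of type $A_{n-1}$ and let $(\gamma,J)$ be a placed shape with $\gamma=(\gamma_1,\dots,\gamma_n)$ dominant and integral (i.e. $\gamma_1\le\dots\le\gamma_n$, $\gamma_i\in\mathbb{Z}$), such that $J$ satisfies: if $\beta\in J$, $\alpha\in Z(\gamma)$ and $\beta-\alpha\in R^+$ then $\beta-\alpha\in J$ (so that $(\gamma,J)$ determines a placed configuration of boxes). Let $t_{\min}$ and $t_{\max}$ be the column reading and row reading tableaux of shape $(\gamma,J)$, respectively, and let $w_{\min}$ and $w_{\max}$ be the corresponding permutations in $\mathcal{F}^{(\gamma,J)}$. Then $$R(w_{\min})=\overline{J},\qquad R(w_{\max})=\overline{(P(\gamma)\setminus J)\cup Z(\gamma)}^{\,c},\qquad \mathcal{F}^{(\gamma,J)}=[w_{\min},w_{\max}],$$ where $K^c$ denotes the complement of $K$ in $R^+$ and $[w_{\min},w_{\max}]$ is the interval between $w_{\min}$ and $w_{\max}$ in the weak Bruhat order.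
   Context: Type $A_{n-1}$: $\{\varepsilon_1,\dots,\varepsilon_n\}$ is an orthonormal basis of $\mathbb{R}^n$, $R=\{\varepsilon_j-\varepsilon_i\mid i\ne j\}$, $R^+=\{\varepsilon_j-\varepsilon_i\mid i<j\}$, $W=S_n$ acts by $w\varepsilon_i=\varepsilon_{w(i)}$, and $\gamma=(\gamma_1,\dots,\gamma_n)$ means $\sum\gamma_i\varepsilon_i$. $R(w)=\{\alpha\in R^+\mid w\alpha\in -R^+\}$. $Z(\gamma)=\{\alpha\in R^+\mid\langle\gamma,\alpha\rangle=0\}$, $P(\gamma)=\{\alpha\in R\mid\langle\gamma,\alpha\rangle=1\}$. A placed shape is a pair $(\gamma,J)$ with $\gamma$ dominant and $J\subseteq P(\gamma)$; $\mathcal{F}^{(\gamma,J)}=\{w\in W\mid R(w)\cap Z(\gamma)=\emptyset,\ R(w)\cap P(\gamma)=J\}$. Weak Bruhat order: $v\le w$ iff $R(v)\subseteq R(w)$. A set $K\subseteq R^+$ is closed if $\alpha,\beta\in K$, $\alpha+\beta\in R^+$ imply $\alpha+\beta\in K$; $\overline{K}$ is the smallest closed subset of $R^+$ containing $K$. Placed configuration of $(\gamma,J)$: boxes $\mathrm{box}_1,\dots,\mathrm{box}_n$ on graph paper with diagonals running northwest to southeast and indexed by $\mathbb{Z}$ increasing from southwest to northeast; $\mathrm{box}_i$ lies on diagonal $\gamma_i$ (its content); boxes on the same diagonal have indices increasing from northwest to southeast; if $\varepsilon_j-\varepsilon_i\in J$ then $\mathrm{box}_j$ is northwest of $\mathrm{box}_i$,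 and if $\varepsilon_j-\varepsilon_i\in P(\gamma)\setminus J$ then $\mathrm{box}_j$ is southeast of $\mathrm{box}_i$. (Boxes may slide along their diagonal; only these relative positions matter.) A filling $t$ of the boxes by $1,\dots,n$ corresponds to the permutation $w$ with $w(i)=t(\mathrm{box}_i)$; fillings corresponding to elements of $\mathcal{F}^{(\gamma,J)}$ are the standard tableaux of shape $(\gamma,J)$. Column reading tableau $t_{\min}$: the minimal box of a set $S$ of boxes of the configuration is the $\mathrm{box}_i\in S$ such that (m1) there is no $\mathrm{box}_j\in S$ on the next higher diagonal lying northwest of it (i.e. no $\mathrm{box}_j\in S$ with $\varepsilon_j-\varepsilon_i\in J$); (m2) there is no $\mathrm{box}_k\in S$ on the next lower diagonal such that $\mathrm{box}_i$ lies southeast of it (i.e. no $\mathrm{box}_k\in S$ with $\varepsilon_i-\varepsilon_k\in P(\gamma)\setminus J$); (m3) there is no $\mathrm{box}_k\in S$ northwest of it on the same diagonal (i.e. no $\mathrm{box}_k\in S$ with $k<i$, $\gamma_k=\gamma_i$); (m4) it has minimal content among boxes of $S$ satisfying (m1)–(m3). The filling $t_{\min}$ is created inductively: put $1$ in the minimal box of the configuration; when $1,\dots,i$ have been filled in, put $i+1$ in the minimal box of the set of unfilled boxes. Row reading tableau $t_{\max}$: let $w_0$ be the longest element of $W$, $W_\gamma$ the stabilizer of $\gamma$, and $u$ the minimal length element of the coset $w_0W_\gamma$. The conjugate of $(\gamma,J)$ is $(\gamma,J)'=(-u\gamma,-u(P(\gamma)\setminus J))$ and the conjugate of $w\in\mathcal{F}^{(\gamma,J)}$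 is $wu^{-1}\in\mathcal{F}^{(\gamma,J)'}$. Then $t_{\max}$ is the standard tableau of shape $(\gamma,J)$ whose conjugate is the column reading tableau of shape $(\gamma,J)'$. *)

(* Defs.v *)
From mathcomp Require Import all_boot all_order all_algebra all_fingroup.
From mathcomp Require Import finmap.
From mathcomp Require Import boolp classical_sets functions cardinality reals.
Set Implicit Arguments.
Unset Strict Implicit.
Unset Printing Implicit Defensive.
Import Order.TTheory GRing.Theory Num.Theory.
Local Open Scope classical_set_scope.
Local Open Scope ring_scope.

(* Indices, permutations and fillings are 0-based: ['I_n] stands for
   {1, ..., n}, with i : 'I_n playing the role of i + 1. *)

Section RootSystem.
Context (R : realType) (n : nat).
Implicit Types (u v x : 'rV[R]_n) (g : 'rV[R]_n) (w : 'S_n).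
Implicit Types (J K : set 'rV[R]_n).

Definition eps (i : 'I_n) : 'rV[R]_n := delta_mx 0 i.

Definition dotv u v : R := \sum_(i < n) u 0 i * v 0 i.

Definition roots : set 'rV[R]_n :=
  [set x | exists i j : 'I_n, i != j /\ x = eps j - eps i].

Definition pos_roots : set 'rV[R]_n :=
  [set x | exists i j : 'I_n, (i < j)%N /\ x = eps j - eps i].

Definition wact w u : 'rV[R]_n := \sum_(i < n) u 0 i *: eps (w i).

Definition inv_set w : set 'rV[R]_n :=
  [set x | pos_roots x /\ pos_roots (- wact w x)].

Definition closed_roots K : Prop :=
  K `<=` pos_roots /\
  forall x y, K x -> K y -> pos_roots (x + y) -> K (x + y).

Definition root_closure K : set 'rV[R]_n := smallest closed_roots K.

Definition weak_le (w1 w2 : 'S_n) : Prop := inv_set w1 `<=` inv_set w2.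

Definition weak_interval (w1 w2 : 'S_n) : set 'S_n :=
  [set w | weak_le w1 w /\ weak_le w w2].

Definition dominant g : Prop := forall i j : 'I_n, (i <= j)%N -> g 0 i <= g 0 j.

Definition integral g : Prop := forall i : 'I_n, g 0 i \is a Num.int.

Definition Zroots g : set 'rV[R]_n := [set x | pos_roots x /\ dotv g x = 0].

Definition Proots g : set 'rV[R]_n := [set x | roots x /\ dotv g x = 1].

Definition placed_shape g J : Prop := dominant g /\ J `<=` Proots g.

(* The permutations w (with w i being the entry of box i) whose fillings are the
   standard tableaux of shape (g, J). *)
Definition tableaux g J : set 'S_n :=
  [set w | inv_set w `&` Zroots g = set0 /\ inv_set w `&` Proots g = J].

(* Box i of a set S of boxes can be filled first, in the configuration
   of (g, J); here [eps j - eps i \in J] says that box j is on the next higher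
   diagonal and northwest of box i, [eps i - eps k \in Proots g \ J] that box k
   is on the next lower diagonal and that box i is southeast of it, and on a
   common diagonal the indices increase from northwest to southeast. *)
Definition unobstructed g J (S : {set 'I_n}) (i : 'I_n) : Prop :=
  [/\ i \in S,
      ~ (exists2 j, j \in S & J (eps j - eps i)),
      ~ (exists2 k, k \in S & (Proots g `\` J) (eps i - eps k)) &
      ~ (exists2 k, k \in S & (k < i)%N /\ g 0 k = g 0 i)].

Definition minimal_box g J (S : {set 'I_n}) (i : 'I_n) : Prop :=
  unobstructed g J S i /\ (forall j, unobstructed g J S j -> g 0 i <= g 0 j).

(* Entry k lies in box t^-1(k), and the boxes unfilled just before k is put in
   are those with entry at least k. *)
Definition column_reading g J (t : 'S_n) : Prop :=
  forall k : 'I_n,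
    minimal_box g J (finset (fun i => k <= t i)%N) ((t^-1)%g k).

Definition perm_length w : nat := #|` fset_set (inv_set w)|.

Definition longest_perm : 'S_n := [arg max_(w > 1%g) perm_length w]%N.

Definition stab g : {set 'S_n} := finset (fun w => wact w g == g).

(* In MathComp [(s * t)%g] is "s, then t", so the coset w_0 W_g is the set of
   the [(v * longest_perm)%g], v \in stab g. *)
Definition conj_perm g : 'S_n :=
  [arg min_(w < longest_perm in (stab g :* longest_perm)%g) perm_length w]%N.

Definition conj_weight g : 'rV[R]_n := - wact (conj_perm g) g.

Definition conj_set g J : set 'rV[R]_n :=
  [set - wact (conj_perm g) x | x in Proots g `\` J].

(* The conjugate w \o u^-1 of w; see [conj_perm] for the order of the product. *)
Definition conj_tableau g w : 'S_n := ((conj_perm g)^-1 * w)%g.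

Definition row_reading g J (t : 'S_n) : Prop :=
  tableaux g J t /\
  column_reading (conj_weight g) (conj_set g J) (conj_tableau g t).

End RootSystem.

Arguments roots : clear implicits.
Arguments pos_roots : clear implicits.
Arguments inv_set R {n} w.
Arguments weak_le R {n} w1 w2.
Arguments weak_interval R {n} w1 w2.
Arguments perm_length R {n} w.
Arguments longest_perm : clear implicits.

(* Main.v *)
(* Let S be the set of unfilled boxes and let no unobstructed box of S have content
   below c.  Then every box i of S of content below c has a box j of S on the next
   diagonal with eps_j - eps_i in J.  Hence S has a minimal box, and when a box is
   filled, each unfilled box of smaller content is joined to it by a chain of
   elements of J, so that the inversions of the column reading lie in the closure
   of J; the other inclusion holds because inversion sets are closed.  As their
   complements are closed too, the row reading is dealt with by conjugation: u
   reverses the order of the diagonals and keeps the order on each diagonal, so the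
   conjugate shape satisfies the same hypotheses. *)
Require Import Defs.
From mathcomp Require Import all_boot all_order all_algebra all_fingroup.
From mathcomp Require Import finmap zify lra.
From mathcomp Require Import boolp classical_sets cardinality reals.
Set Implicit Arguments.
Unset Strict Implicit.
Unset Printing Implicit Defensive.
Import Order.TTheory GRing.Theory Num.Theory.
Local Open Scope classical_set_scope.
Local Open Scope ring_scope.

(** * Roots of type A as pairs of indices, and closed sets of roots *)

Section Roots.
Context (R : realType) (n : nat).
Implicit Types (i j k a b p q : 'I_n) (w : 'S_n) (g : 'rV[R]_n).
Implicit Types (J K : set 'rV[R]_n).
Local Notation rt j i := (eps R j - eps R i).

Lemma perm_ltnN w i j : (i < j)%N -> (w i < w j)%N = ~~ (w j < w i)%N.
Proof.
move=> ij; rewrite -leqNgt ltn_neqAle andb_idl // => _; rewrite (inj_eq val_inj)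
  (inj_eq perm_inj); by apply: contraTneq ij => ->; rewrite ltnn.
Qed.

Lemma epsE i k : eps R i 0 k = (k == i)%:R.
Proof. by rewrite mxE eqxx. Qed.

Lemma rtE i j k : (rt j i) 0 k = (k == j)%:R - (k == i)%:R.
Proof. by rewrite !mxE !eqxx. Qed.

Lemma rt_inj i j a b : i != j -> rt j i = rt b a -> j = b /\ i = a.
Proof.
move=> ij e; split; apply/eqP.
- have /= := congr1 (fun x : 'rV_n => x 0 j) e.
  move: e => _; rewrite !rtE eqxx eq_sym (negPf ij).
  by case: (j == b) => //; case: (j == a) => /= ?; exfalso; lra.
- have /= := congr1 (fun x : 'rV_n => x 0 i) e.
  move: e => _; rewrite !rtE eqxx (negPf ij).
  by case: (i == a) => //; case: (i == b) => /= ?; exfalso; lra.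
Qed.

(** If both equalities fail, the coordinates of the sum at [j] and at [b] are positive: either
    [j = b] and this coordinate is 2, or there are two distinct coordinates equal to 1. Neither
    occurs in a difference of two basis vectors. *)
Lemma rt_add i j a b p q :
  i != j -> a != b -> rt j i + rt b a = rt q p -> i = b \/ j = a.
Proof.
move=> ij ab e; case: (i =P b) => [->|/eqP ib]; first by left.
case: (j =P a) => [->|/eqP ja]; first by right.
have /= := congr1 (fun x : 'rV_n => x 0 j) e.
have /= := congr1 (fun x : 'rV_n => x 0 b) e.
move: e => _; rewrite ![(_ + rt b a) 0 _]mxE !rtE !eqxx.
rewrite ![_ == i]eq_sym (negPf ij) (negPf ib).
rewrite (negPf ja) (eq_sym b a) (negPf ab).
case: (eqVneq j b) => [<-|jb].
  by case: (j == q); case: (j == p) => /= *; exfalso; lra.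
case: (eqVneq j q) => [jq|_].
  rewrite -{}jq eq_sym (negPf jb).
  by case: (b == p); case: (j == p) => /= *; exfalso; lra.
by case: (j == p) => /= *; exfalso; lra.
Qed.

Lemma pos_rt i j : pos_roots R n (rt j i) <-> (i < j)%N.
Proof.
split=> [[a [b [ab e]]]|ij]; last by exists i, j.
have ab' : a != b by apply: contraTneq ab => ->; rewrite ltnn.
by have [<- <-] := rt_inj ab' (esym e).
Qed.

Lemma rootsE i j : Defs.roots R n (rt j i) <-> i != j.
Proof.
split=> [[a [b [ab e]]]|ij]; last by exists i, j.
by have [<- <-] := rt_inj ab (esym e).
Qed.

Lemma wact_eps w i : wact w (eps R i) = eps R (w i).
Proof.
rewrite /wact (bigD1 i) //= epsE eqxx scale1r big1 ?addr0 // => j /negPf ji.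
by rewrite epsE ji scale0r.
Qed.

Lemma wactB w x y : wact w (x - y : 'rV[R]_n) = wact w x - wact w y.
Proof.
by rewrite /wact -sumrB; apply: eq_bigr => i _; rewrite !mxE scalerBl.
Qed.

Lemma wact_rt w i j : wact w (rt j i) = rt (w j) (w i).
Proof. by rewrite wactB !wact_eps. Qed.

Lemma wactE w g i : wact w g 0 (w i) = g 0 i.
Proof.
rewrite /wact summxE (bigD1 i) //= mxE epsE eqxx mulr1 big1 ?addr0 // => j ji.
by rewrite mxE epsE (inj_eq perm_inj) eq_sym (negPf ji) mulr0.
Qed.

Lemma inv_rt w i j : inv_set R w (rt j i) <-> (i < j)%N /\ (w j < w i)%N.
Proof.
by rewrite /inv_set /= wact_rt opprB; split=> -[/pos_rt ? /pos_rt ?].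
Qed.

Lemma inv_setP w x :
  inv_set R w x ->
  exists i j, [/\ (i < j)%N, (w j < w i)%N & x = rt j i].
Proof.
move=> h; have [[i [j [_ e]]] _] := h.
by move: h; rewrite e => /inv_rt[? ?]; exists i, j.
Qed.

Lemma dotv_rt g i j : dotv g (rt j i) = g 0 j - g 0 i.
Proof.
rewrite /dotv; under eq_bigr do rewrite rtE mulrBr.
rewrite sumrB (bigD1 j) //= (bigD1 (P := xpredT) i) //= !eqxx !mulr1.
rewrite !big1 ?addr0 // => k /negPf ->; by rewrite mulr0.
Qed.

Lemma Zroots_rt g i j : Zroots g (rt j i) <-> (i < j)%N /\ g 0 j = g 0 i.
Proof.
rewrite /Zroots /= dotv_rt; split=> -[/pos_rt ij e]; split => //; lra.
Qed.

Lemma Proots_rt g i j : Proots g (rt j i) <-> g 0 j = g 0 i + 1.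
Proof.
rewrite /Proots /= dotv_rt; split=> [[_ e]|e]; first lra.
by split; [apply/rootsE/eqP => ij; rewrite {}ij in e; lra|lra].
Qed.

Lemma ProotsP g x :
  Proots g x -> exists i j, g 0 j = g 0 i + 1 /\ x = rt j i.
Proof.
move=> h; have [[i [j [_ e]]] _] := h.
by move: h; rewrite e => /Proots_rt ?; exists i, j.
Qed.

Lemma closed_roots_trans K i j k :
  closed_roots K -> K (rt k j) -> K (rt j i) -> K (rt k i).
Proof.
case=> Kpos Kadd kj ji; rewrite -(subrKA (eps R j)); apply: Kadd => //.
rewrite subrKA; apply/pos_rt.
by apply: (@ltn_trans j); apply/pos_rt; apply: Kpos.
Qed.

(** By [rt_add], two positive roots can only add up to a root by sharing a middle index, so
    closedness reduces to transitivity of a relation on indices. *)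
Lemma closed_rootsI K :
  K `<=` pos_roots R n ->
  (forall i j k, K (rt k j) -> K (rt j i) -> K (rt k i)) -> closed_roots K.
Proof.
move=> Kpos Ktr; split=> // x y Kx Ky [p [q [pq e]]].
have [i [j [ij ex]]] := Kpos _ Kx; have [a [b [ab ey]]] := Kpos _ Ky.
have ne (c d : 'I_n) : (c < d)%N -> c != d by rewrite ltn_neqAle => /andP[].
rewrite ex ey in Kx Ky e *.
have [eib|eja] := rt_add (ne _ _ ij) (ne _ _ ab) e.
- by rewrite eib in Kx *; rewrite subrKA; apply: Ktr Kx Ky.
- by rewrite eja in Kx *; rewrite addrC subrKA; apply: Ktr Ky Kx.
Qed.

Lemma closed_inv_set w : closed_roots (inv_set R w).
Proof.
apply: closed_rootsI => [x [] //|i j k /inv_rt[jk wkj] /inv_rt[ij wji]].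
by apply/inv_rt; split; [apply: ltn_trans jk|apply: ltn_trans wji].
Qed.

Lemma closed_setD_inv_set w : closed_roots (pos_roots R n `\` inv_set R w).
Proof.
apply: closed_rootsI => [x []//|i j k [/pos_rt jk kj] [/pos_rt ij ji]].
split; first by apply/pos_rt; apply: ltn_trans jk.
move=> /inv_rt[_ ki]; case: (ltnP (w j) (w i)) => wji.
- by apply: ji; apply/inv_rt.
- by apply: kj; apply/inv_rt; split=> //; apply: leq_trans wji.
Qed.

(** The set of positive roots is itself closed, so it takes part in the intersection defining the
    closure and bounds it. *)
Lemma closed_root_closure K :
  K `<=` pos_roots R n -> closed_roots (root_closure K).
Proof.
move=> Kpos; split.
  by apply: smallest_sub => //; split.
by move=> x y hx hy xy A AK; apply: AK.1.2 => //; [apply: hx|apply: hy].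
Qed.

End Roots.

(** * Existence, uniqueness and inversions of the column reading tableau *)

Section ColumnReading.
Context (R : realType) (n : nat) (g : 'rV[R]_n) (J : set 'rV[R]_n).
Implicit Types (i j k l : 'I_n) (S : {set 'I_n}) (t : 'S_n).
Local Notation rt j i := (eps R j - eps R i).

(** The hypothesis on [J] in geometric form, used at both ends of a root: a box northwest of another
    stays so when the first slides to an earlier place of its diagonal and the second to a later
    place of its own. In this form it passes to the conjugate shape. *)
Definition nw_stable : Prop := forall i j k l,
  J (rt j i) -> g 0 k = g 0 j -> (k <= j)%N -> g 0 l = g 0 i -> (i <= l)%N ->
  J (rt k l).

(** Membership in [tableaux] as inequalities between entries (see [tableauxP]), which can be
    compared directly with the conditions for an unobstructed box. *)
Definition standard_filling t : Prop :=
  [/\ forall i j, J (rt j i) -> (t j < t i)%N,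
      forall i j, (Proots g `\` J) (rt j i) -> (t i < t j)%N &
      forall i j, (i < j)%N -> g 0 j = g 0 i -> (t i < t j)%N].

Hypotheses (gdom : dominant g) (JP : J `<=` Proots g) (Jst : nw_stable).

Lemma dominant_lt i j : g 0 i < g 0 j -> (i < j)%N.
Proof. by rewrite ltNge [(i < j)%N]ltnNge; apply: contraNN => /gdom. Qed.

Lemma Proots_lt i j : Proots g (rt j i) -> (i < j)%N.
Proof. by move=> /Proots_rt e; apply: dominant_lt; rewrite e ltrDl. Qed.

Lemma Proots_pos : Proots g `<=` pos_roots R n.
Proof.
by move=> x /[dup] /ProotsP[i [j [_ ->]]] /Proots_lt ?; apply/pos_rt.
Qed.

Lemma tableauxP t : tableaux g J t <-> standard_filling t.
Proof.
split=> [[tZ tP]|[tJ tN tZ]].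
  have inP x : J x <-> inv_set R t x /\ Proots g x by rewrite -tP.
  split=> [i j /inP[/inv_rt[]//]|i j [ij nJ]|i j ij gij].
  - have lij := Proots_lt ij; rewrite perm_ltnN //.
    by apply/negP => tji; apply/nJ/inP; split=> //; apply/inv_rt.
  - rewrite perm_ltnN //; apply/negP => tji.
    suff: (inv_set R t `&` Zroots g) (rt j i) by rewrite tZ.
    by split; [apply/inv_rt|apply/Zroots_rt].
split.
  apply/seteqP; split=> // x [/inv_setP[i [j [ij tij ->]]] /Zroots_rt[_ gij]].
  by have := tZ _ _ ij gij; rewrite ltnNge ltnW.
apply/seteqP; split=> x.
- move=> [/inv_setP[i [j [ij tij ->]]] ijP]; apply: contrapT => nJ.
  by have := tN _ _ (conj ijP nJ); rewrite ltnNge ltnW.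
- move=> /[dup] Jx /JP /[dup] /ProotsP[i [j [_ ex]]]; rewrite {}ex in Jx *.
  by move=> ijP; split=> //; apply/inv_rt; split; [apply: Proots_lt|apply: tJ].
Qed.

(* The first box of the diagonal of [i] in [S] has two possible obstructions: an
   element of [J] gives the conclusion at once, and an obstruction from the
   previous diagonal is excluded by applying the statement there. *)
Lemma lt_unobstructed_J S (B : R) :
  (forall i, unobstructed g J S i -> B <= g 0 i) ->
  forall i, i \in S -> g 0 i < B -> exists2 j, j \in S & J (rt j i).
Proof.
move=> hB i; have [m] := ubnP (val i); elim: m i => // m IH i im iS iB.
apply: contrapT => no_j.
have [|f /andP[fS /eqP gf] fmin] := @arg_minnP _ i
    (fun f => (f \in S) && (g 0 f == g 0 i)) (@nat_of_ord n).
  by rewrite iS eqxx.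
have fi : (f <= i)%N by apply: fmin; rewrite iS eqxx.
suff : unobstructed g J S f by move=> /hB; rewrite gf leNgt iB.
split=> // -[k kS].
- by move=> Jkf; apply: no_j; exists k => //; apply: Jst Jkf _ _ _ _.
- move=> [fkP nJ]; have kf := Proots_lt fkP.
  move/Proots_rt: fkP => gfk.
  have [||j jS Jjk] := IH k _ kS.
  + by apply: leq_trans kf _; apply: leq_trans fi _.
  + by apply: lt_trans iB; rewrite -gf gfk ltrDl.
  (* Box [j] lies on the diagonal of [f], hence not before [f] by the choice of [f]; stability then
     replaces [j] by [f], contradicting [nJ]. *)
  have /Proots_rt gjk := JP Jjk.
  have gfj : g 0 f = g 0 j by rewrite gfk gjk.
  by apply/nJ/(Jst Jjk) => //; apply: fmin; rewrite jS -gf gfj eqxx.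
- move=> [kf gkf]; have := fmin k; rewrite kS gkf gf eqxx leqNgt kf.
  by move=> /(_ isT).
Qed.

(** If no box were unobstructed, any bound would do in [lt_unobstructed_J]. One more than the
    largest content in [S] then yields a box of [S] of still larger content. *)
Lemma minimal_box_exists S i0 : i0 \in S -> exists i, minimal_box g J S i.
Proof.
move=> i0S; have [u uS] : exists u, unobstructed g J S u.
  apply: contrapT => no_u.
  have [m mS mmax] := @Order.TotalTheory.arg_maxP _ _ _ i0 (mem S) (g 0) i0S.
  have [i iU|//||j jS /JP/Proots_rt gjm] :=
    @lt_unobstructed_J S (g 0 m + 1) _ m.
  - by case: no_u; exists i.
  - by rewrite ltrDl.
  - by have /= := mmax _ jS; rewrite gjm gerDl ler10.
have /= [|i /asboolP iS imin] :=
    @Order.TotalTheory.arg_minP _ _ _ u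
   (fun i => `[< unobstructed g J S i >]) (g 0); first exact/asboolP.
by exists i; split=> // j /asboolP; apply: imin.
Qed.

Lemma minimal_box_uniq S i j :
  minimal_box g J S i -> minimal_box g J S j -> i = j.
Proof.
move=> [iU imin] [jU jmin].
have gij : g 0 i = g 0 j by apply/eqP; rewrite eq_le imin ?jmin.
have [iS _ _ iZ] := iU; have [jS _ _ jZ] := jU.
apply: val_inj; case: (ltngtP i j) => // ij; exfalso.
- by apply: jZ; exists i.
- by apply: iZ; exists j.
Qed.

Lemma column_reading_box t i : column_reading g J t ->
  minimal_box g J (finset (fun l => t i <= t l)%N) i.
Proof. by move=> /(_ (t i)); rewrite permK. Qed.

(** Strong induction on the entry: once the smaller entries sit in the same boxes, the sets of
    unfilled boxes agree, and so do their minimal boxes. *)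
Lemma column_reading_uniq t1 t2 :
  column_reading g J t1 -> column_reading g J t2 -> t1 = t2.
Proof.
move=> h1 h2; suff e k : (t1^-1)%g k = (t2^-1)%g k.
  by apply: invg_inj; apply/permP.
have [m] := ubnP (val k); elim: m k => // m IH k km.
have e l : (k <= t1 l)%N = (k <= t2 l)%N.
  rewrite [LHS]leqNgt [RHS]leqNgt; congr negb; apply/idP/idP => kl.
  - have := congr1 t2 (IH (t1 l) (leq_trans kl km)).
    by rewrite permK permKV => ->.
  - have := congr1 t1 (IH (t2 l) (leq_trans kl km)).
    by rewrite permK permKV => <-.
apply: minimal_box_uniq (h1 k) _.
by rewrite (_ : finset _ = finset (fun i => k <= t2 i)%N) //;
  apply/setP => l; rewrite !inE e.
Qed.

Lemma column_reading_exists : exists t, column_reading g J t.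
Proof.
case: (posnP n) => [n0|n_gt0].
  by exists 1%g => -[k kn]; exfalso; rewrite n0 in kn.
pose x0 := Ordinal n_gt0.
(* The list [s] gives the boxes in the order of filling, built greedily; [take k s] holds the boxes
   filled before entry [k], and the tableau sends a box to its position in [s]. *)
have [s [us ss hs]] : exists s : seq 'I_n, [/\ uniq s, size s = n &
    forall k, (k < n)%N ->
      minimal_box g J (finset (fun i => i \notin take k s)) (nth x0 s k)].
  suff: forall m, (m <= n)%N -> exists s : seq 'I_n, [/\ uniq s, size s = m &
    forall k, (k < m)%N ->
      minimal_box g J (finset (fun i => i \notin take k s)) (nth x0 s k)].
    exact.
  elim=> [|m IH] mn; first by exists [::].
  have [s [us ss hs]] := IH (ltnW mn).
  have [i0 i0s] : exists i, i \notin s.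
    apply/existsP; rewrite -negb_forall; apply/negP => /forallP all_s.
    have := uniq_leq_size (enum_uniq 'I_n) (fun i _ => all_s i).
    by rewrite size_enum_ord ss leqNgt mn.
  have [|i hi] := @minimal_box_exists (finset (fun i => i \notin s)) i0.
    by rewrite inE.
  exists (rcons s i); split; last 2 first.
  - by rewrite size_rcons ss.
  - move=> k; rewrite ltnS leq_eqVlt => /predU1P[->|km].
      by rewrite -ss -cats1 take_size_cat // nth_cat ltnn subnn.
    rewrite -cats1 takel_cat ?ss ?(ltnW km) // nth_cat ss km.
    exact: hs.
  - by rewrite rcons_uniq us andbT; have [[]] := hi; rewrite inE.
have pinj : injective (fun k : 'I_n => nth x0 s k).
  by move=> k l /eqP; rewrite nth_uniq ?ss // => /eqP/val_inj.
exists (perm pinj)^-1%g => k; rewrite invgK permE.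
rewrite (_ : finset _ = finset (fun i => i \notin take k s)); first exact: hs.
apply/setP => i; rewrite !inE.
set l := (perm pinj)^-1%g i.
have ->: i = nth x0 s l by rewrite -[LHS](permKV (perm pinj)) permE.
by rewrite in_take ?mem_nth ?ss // index_uniq ?ss // -leqNgt.
Qed.

Lemma column_reading_standard t : column_reading g J t -> standard_filling t.
Proof.
move=> ht; split=> i j.
- have [[_ h _ _] _] := column_reading_box i ht.
  move=> ji; rewrite ltnNge; apply/negP => tij.
  by apply: h; exists j; rewrite ?inE.
- have [[_ _ h _] _] := column_reading_box j ht.
  move=> ji; rewrite ltnNge; apply/negP => tij.
  by apply: h; exists i; rewrite ?inE.
- have [[_ _ _ h] _] := column_reading_box j ht.
  move=> ij gij; rewrite ltnNge; apply/negP => tij.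
  by apply: h; exists i; rewrite ?inE.
Qed.

Lemma standard_inv_lt t i j : standard_filling t ->
  (i < j)%N -> (t j < t i)%N -> g 0 i < g 0 j.
Proof.
move=> [_ _ tZ] ij tji; rewrite lt_neqAle (gdom (ltnW ij)) andbT.
by apply: contraTneq tji => gij; rewrite -leqNgt ltnW // tZ.
Qed.

(** When box [j] is filled, box [i] is still empty and has smaller content, so [lt_unobstructed_J]
    lets one climb from [i] by elements of [J], one diagonal at a time, up to [j]. The relation [T]
    is left arbitrary to serve both the closure of [J] and, through conjugation, the closure
    attached to the row reading. *)
Lemma column_reading_inv_ind (T : 'I_n -> 'I_n -> Prop) t :
  integral g -> column_reading g J t ->
  (forall i j, J (rt j i) -> T j i) ->
  (forall i j k, T k j -> T j i -> T k i) ->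
  forall i j, (i < j)%N -> (t j < t i)%N -> T j i.
Proof.
move=> gint ht TJ Ttr i j ij tji.
have st := column_reading_standard ht; have [_ _ tZ] := st.
have [_ jmin] := column_reading_box j ht.
have := standard_inv_lt st ij tji; move/ltnW: tji => {ij}.
have [m] := ubnP (j - i)%N; elim: m i => // m IH i im tji gij.
have [|l] := lt_unobstructed_J jmin _ gij; rewrite inE // => tjl Jli.
have /Proots_rt gl := JP Jli.
(* Integrality enters here: a step of 1 from below cannot jump over the diagonal of [j]. *)
have: g 0 l <= g 0 j.
  move: gij; rewrite gl.
  have /intrP[a ->] := gint i; have /intrP[b ->] := gint j.
  by rewrite ltr_int -lezD1 -(ler_int R) intrD.
rewrite le_eqVlt => /predU1P[glj|glj].
  (* The chain has reached the diagonal of [j]. As [l] is not filled before [j], it does not precede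
     [j] there, and stability replaces [l] by [j]. *)
  apply/TJ/(Jst Jli) => //; rewrite leqNgt; apply/negP => lj.
  by have := tZ _ _ lj (esym glj); rewrite ltnNge tjl.
apply: (Ttr _ l); last exact: TJ.
apply: IH => //; have := dominant_lt glj => lj.
have il := Proots_lt (JP Jli).
move: im; rewrite ltnS; apply: leq_trans.
by apply: ltn_sub2l => //; apply: ltn_trans lj.
Qed.

End ColumnReading.

(** * The longest permutation and the minimal coset representative [conj_perm] *)

Section ConjPerm.
Context (R : realType) (n : nat).
Implicit Types (i j k l : 'I_n) (w : 'S_n) (g : 'rV[R]_n).
Local Notation rt j i := (eps R j - eps R i).

Lemma finite_pos_roots : finite_set (pos_roots R n).
Proof.
apply: (@sub_finite_set _ _ [set rt p.2 p.1 | p in [set: 'I_n * 'I_n]]).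
  by move=> x [i [j [_ ->]]]; exists (i, j).
by apply: finite_image; apply: finite_finset.
Qed.

Lemma finite_inv_set w : finite_set (inv_set R w).
Proof. by apply: sub_finite_set finite_pos_roots => x []. Qed.

(** The order-reversing permutation inverts every positive root, so a permutation of maximal length
    must do the same. *)
Lemma longest_perm_ltn i j :
  (i < j)%N -> (longest_perm R n j < longest_perm R n i)%N.
Proof.
move=> ij; rewrite /longest_perm; case: arg_maxnP => // w _ wmax.
have invT : inv_set R (perm (@rev_ord_inj n)) = pos_roots R n.
  apply/seteqP; split=> [x []//|x [a [b [ab ->]]]].
  by apply/inv_rt; split=> //; rewrite !permE /=; have := ltn_ord b; lia.
suff e : inv_set R w = pos_roots R n.
  by have /inv_rt[] : inv_set R w (rt j i) by rewrite e; apply/pos_rt.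
apply: fset_set_inj; [exact: finite_inv_set|exact: finite_pos_roots|].
apply/eqP; rewrite eqEfcard; apply/andP; split.
  rewrite -fset_set_sub; [by move=> x []|exact: finite_inv_set|].
  exact: finite_pos_roots.
by have := wmax (perm (@rev_ord_inj n)) isT; rewrite /perm_length invT.
Qed.

Lemma mem_stab g w : w \in stab g <-> forall i, g 0 (w i) = g 0 i.
Proof.
rewrite inE; split=> [/eqP e i|e]; first by rewrite -{1}e wactE.
by apply/eqP/rowP => i; rewrite -(permKV w i) wactE -e.
Qed.

Lemma longest_perm_coset g :
  longest_perm R n \in (stab g :* longest_perm R n)%g.
Proof.
apply/rcosetP; exists 1%g; last by rewrite mul1g.
by apply/mem_stab => i; rewrite perm1.
Qed.

Lemma conj_permP g :
  exists2 v : 'S_n, forall i, g 0 (v i) = g 0 i &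
    conj_perm g = (v * longest_perm R n)%g.
Proof.
rewrite /conj_perm; case: arg_minnP => [|u uP _].
  exact: longest_perm_coset.
by have /rcosetP[v /mem_stab vst ->] := uP; exists v.
Qed.

Lemma conj_perm_min g w : (forall i, g 0 (w i) = g 0 i) ->
  (perm_length R (conj_perm g) <= perm_length R (w * conj_perm g)%g)%N.
Proof.
move=> wst; have [v vst eu] := conj_permP g; rewrite {2}eu mulgA.
rewrite /conj_perm; case: arg_minnP => [|u uP umin].
  exact: longest_perm_coset.
apply: umin; apply/rcosetP; exists (w * v)%g => //.
by apply/mem_stab => i; rewrite permM vst wst.
Qed.

(** The simple reflection [s] permutes the positive roots other than its own simple root. Hence it
    maps the inversions of the product injectively to inversions of [w], and it misses the simple
    root, which is an inversion of [w]. *)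
Lemma perm_length_tperm_adj w i j : j = i.+1 :> nat -> (w j < w i)%N ->
  (perm_length R (tperm i j * w)%g < perm_length R w)%N.
Proof.
move=> ij wij; set s := tperm i j; set A := fset_set (inv_set R (s * w)%g).
have inA x : x \in A ->
    exists a b : 'I_n,
      [/\ (a < b)%N, (s a < s b)%N, (w (s b) < w (s a))%N & x = rt b a].
  rewrite /A in_fset_set; last exact: finite_inv_set.
  move=> /set_mem/inv_setP[a [b [ab]]]; rewrite !permM => wab ->.
  exists a, b; split=> //; move: ab wab; rewrite /s.
  by case: tpermP => [->|->|/eqP + /eqP +];
    case: tpermP => [->|->|/eqP + /eqP +];
    rewrite -?val_eqE /= ?ij; move: ij wij; lia.
have cardA : #|` A| = #|` [fset wact s x | x in A]%fset|.
  rewrite card_in_imfset // => x y /inA[a [b [ab sab _ ->]]].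
  move=> /inA[c [d [cd scd _ ->]]]; rewrite !wact_rt => /rt_inj[|].
    by apply: contraTneq sab => ->; rewrite ltnn.
  by move=> /perm_inj-> /perm_inj->.
rewrite /perm_length -/A cardA; apply: fproper_ltn_card.
apply: (@fsub_proper_trans _ (fset_set (inv_set R w) `\ rt j i)%fset).
  apply/fsubsetP => y /imfsetP[x /= /inA[a [b [ab sab wab ->]]] ->].
  rewrite wact_rt in_fsetD1 in_fset_set; last exact: finite_inv_set.
  apply/andP; split; last by apply/mem_set/inv_rt.
  apply/eqP => /rt_inj[|sb sa].
    by apply: contraTneq sab => ->; rewrite ltnn.
  have ea : a = j by apply: (@perm_inj _ s); rewrite sa tpermR.
  have eb : b = i by apply: (@perm_inj _ s); rewrite sb tpermL.
  by move: ab; rewrite ea eb ij ltnNge leqnSn.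
apply: fproperD1; rewrite in_fset_set; last exact: finite_inv_set.
by apply/mem_set/inv_rt; rewrite ij.
Qed.

Context (g : 'rV[R]_n) (gdom : dominant g).

Lemma conj_perm_gt i j : g 0 i < g 0 j -> (conj_perm g j < conj_perm g i)%N.
Proof.
have [v vst ->] := conj_permP g; rewrite !permM => gij.
by apply/longest_perm_ltn/(dominant_lt gdom); rewrite !vst.
Qed.

(** A descent between neighbours of equal content could be removed by a transposition in the
    stabilizer, against the minimal length of [u]. Dominance makes each diagonal an interval of
    indices, so neighbours suffice. *)
Lemma conj_perm_lt i j :
  (i < j)%N -> g 0 i = g 0 j -> (conj_perm g i < conj_perm g j)%N.
Proof.
set u := conj_perm g.
have adj (a b : 'I_n) : b = a.+1 :> nat -> g 0 a = g 0 b -> (u a < u b)%N.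
  move=> ab gab; have ltab : (a < b)%N by rewrite ab.
  rewrite perm_ltnN //; apply/negP => uba.
  have := perm_length_tperm_adj ab uba; rewrite ltnNge conj_perm_min // => k.
  by case: tpermP => // ->.
have [m] := ubnP (j - i)%N; elim: m i => // m IH i jim ij gij.
have kn : (i.+1 < n)%N by apply: leq_ltn_trans (ltn_ord j).
pose k := Ordinal kn.
have gik : g 0 i = g 0 k.
  by apply/eqP; rewrite eq_le (@gdom i k (leqnSn i)) gij gdom.
apply: (@leq_trans (u k)); first exact: adj.
case: (ltngtP k j) => [kj|/(leq_ltn_trans ij)|/val_inj<-//].
- apply/ltnW/IH => //; last by rewrite -gik.
  by move: jim kj; rewrite /k /=; lia.
- by rewrite ltnn.
Qed.

End ConjPerm.

(** * Transport to the conjugate shape, and the two inversion sets *)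

Section Conjugation.
Context (R : realType) (n : nat) (g : 'rV[R]_n) (J : set 'rV[R]_n).
Hypotheses (gdom : dominant g) (JP : J `<=` Proots g) (Jst : nw_stable g J).
Implicit Types (i j k l : 'I_n) (t w : 'S_n).
Local Notation rt j i := (eps R j - eps R i).
Local Notation u := (conj_perm g).
Local Notation g' := (conj_weight g).
Local Notation J' := (conj_set g J).

Lemma conj_perm_ltE i j :
  (u i < u j)%N = (g 0 j < g 0 i) || (g 0 i == g 0 j) && (i < j)%N.
Proof.
case: ltgtP => [gji|gij|gij] /=; first exact: conj_perm_gt.
- by rewrite ltnNge ltnW //; apply: conj_perm_gt.
- case: (ltngtP i j) => [ij|ji|/val_inj->]; last by rewrite ltnn.
  + exact: conj_perm_lt.
  + by rewrite ltnNge ltnW //; apply: conj_perm_lt.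
Qed.

Lemma conj_weightE i : g' 0 (u i) = - g 0 i.
Proof. by rewrite mxE wactE. Qed.

Lemma conj_setE i j : J' (rt (u i) (u j)) <-> (Proots g `\` J) (rt j i).
Proof.
split=> [[x xPJ]|ijPJ]; last by exists (rt j i); rewrite ?wact_rt ?opprB.
have [a [b [gab ex]]] := ProotsP xPJ.1; rewrite {}ex in xPJ *.
rewrite wact_rt opprB => /rt_inj[|/perm_inj<- /perm_inj<-//].
rewrite (inj_eq perm_inj) -(inj_eq val_inj) gtn_eqF //.
by rewrite (Proots_lt gdom xPJ.1).
Qed.

Lemma conj_dominant : dominant g'.
Proof.
move=> p q; rewrite -(permKV u p) -(permKV u q) !conj_weightE lerN2.
by rewrite leNgt leqNgt conj_perm_ltE; apply: contraNN => ->.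
Qed.

Lemma conj_integral : integral g -> integral g'.
Proof. by move=> gint p; rewrite -(permKV u p) conj_weightE rpredN. Qed.

Lemma conj_set_sub : J' `<=` Proots g'.
Proof.
move=> _ [x [/ProotsP[i [j [gij ->]]] _] <-].
by rewrite wact_rt opprB; apply/Proots_rt; rewrite !conj_weightE gij; lra.
Qed.

(** This is the contrapositive of stability for [J]: conjugation reverses roots, keeps the order on
    each diagonal, and replaces [J] by its complement in [Proots g]. *)
Lemma conj_nw_stable : nw_stable g' J'.
Proof.
move=> q p r s; rewrite -(permKV u p) -(permKV u q) -(permKV u r) -(permKV u s).
move: (_ p) (_ q) (_ r) (_ s) => i j k l.
rewrite !conj_weightE => /conj_setE[/Proots_rt gij nJ] /oppr_inj gki.
rewrite leqNgt conj_perm_ltE gki ltxx eqxx -leqNgt => ki /oppr_inj glj.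
rewrite leqNgt conj_perm_ltE glj ltxx eqxx -leqNgt => jl.
apply/conj_setE; split; first by apply/Proots_rt; rewrite glj gki.
by move=> Jlk; apply/nJ/(Jst Jlk); rewrite ?gki ?glj.
Qed.

Lemma conj_tableauE w i : conj_tableau g w (u i) = w i.
Proof. by rewrite permM permK. Qed.

(** Conjugation exchanges the clause for [J] with the clause for its complement and preserves the
    one for a common diagonal. *)
Lemma conj_standard w :
  standard_filling g' J' (conj_tableau g w) -> standard_filling g J w.
Proof.
move=> [tJ tN tZ]; split=> i j.
- move=> Jij; rewrite -(conj_tableauE w i) -(conj_tableauE w j).
  apply: tN; split; last first.
    by move=> /conj_setE[_ /(_ Jij)].
  by have /Proots_rt e := JP Jij; apply/Proots_rt; rewrite !conj_weightE e; lra.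
- move=> PJij; rewrite -(conj_tableauE w i) -(conj_tableauE w j).
  exact/tJ/conj_setE.
- move=> ij gij; rewrite -(conj_tableauE w i) -(conj_tableauE w j).
  apply: tZ; last first.
    by rewrite !conj_weightE gij.
  by rewrite conj_perm_ltE gij eqxx ij orbT.
Qed.

Lemma Proots_setD_Zroots_pos : (Proots g `\` J) `|` Zroots g `<=` pos_roots R n.
Proof. by move=> x [[/(Proots_pos gdom)]|[]]. Qed.

(** Both inclusions use minimality of a closure: the inversion set is closed and contains [J], while
    its complement is closed and contains the other generators. *)
Lemma standard_closure_sub w : standard_filling g J w ->
  root_closure J `<=` inv_set R w /\ inv_set R w `<=`
    pos_roots R n `\` root_closure ((Proots g `\` J) `|` Zroots g).
Proof.
move=> /(tableauxP gdom JP)[wZ wP]; split.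
  apply: smallest_sub; first exact: closed_inv_set.
  by rewrite -wP => x [].
move=> x xw; split; first by case: xw.
suff sub : root_closure ((Proots g `\` J) `|` Zroots g) `<=`
    pos_roots R n `\` inv_set R w by move=> /sub[].
apply: smallest_sub; first exact: closed_setD_inv_set.
move=> y yPZ; split; first exact: Proots_setD_Zroots_pos.
case: yPZ => [[yP nJ] yw|yZ yw].
- by apply: nJ; rewrite -wP.
- by suff: (inv_set R w `&` Zroots g) y by rewrite wZ.
Qed.

Lemma column_reading_inv_set t : integral g -> column_reading g J t ->
  inv_set R t = root_closure J.
Proof.
move=> gint ht; have st := column_reading_standard ht.
apply/seteqP; split; last by have [] := standard_closure_sub st.
move=> _ /inv_setP[i [j [ij tji ->]]].
apply: (column_reading_inv_ind gdom JP Jst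
  (T := fun j i => root_closure J (rt j i)) gint ht _ _ ij tji).
- by move=> a b; apply: sub_gen_smallest.
- move=> a b c; apply: closed_roots_trans; apply: closed_root_closure.
  exact: subset_trans (Proots_pos gdom).
Qed.

Lemma row_reading_inv_set w :
  integral g -> column_reading g' J' (conj_tableau g w) ->
  inv_set R w = pos_roots R n `\` root_closure ((Proots g `\` J) `|` Zroots g).
Proof.
set C := root_closure _ => gint ht.
have st := conj_standard (column_reading_standard ht).
apply/seteqP; split; first by have [] := standard_closure_sub st.
move=> x [[i [j [ij ->]]] nC]; apply/inv_rt; split=> //.
rewrite ltnNge leq_eqVlt (inj_eq val_inj) (inj_eq perm_inj) -[_ == _]/(i == j).
apply/negP => /predU1P[eij|wij]; first by rewrite eij ltnn in ij.
apply: nC.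
have Ctr a b c : C (rt c b) -> C (rt b a) -> C (rt c a).
  apply: closed_roots_trans; apply: closed_root_closure.
  exact: Proots_setD_Zroots_pos.
(* A non-inversion within one diagonal is in [Zroots g]; between two diagonals it becomes an
   inversion of the conjugate tableau, because [u] reverses the diagonals. *)
have := gdom (ltnW ij); rewrite le_eqVlt => /predU1P[gij|gij].
  by apply: sub_gen_smallest; right; apply/Zroots_rt.
(* The arguments are swapped to absorb the sign in [conj_set]. *)
pose T p q := C (rt ((u^-1)%g q) ((u^-1)%g p)).
suff : T (u i) (u j) by rewrite /T !permK.
apply: (column_reading_inv_ind conj_dominant conj_set_sub conj_nw_stable
  (T := T) (conj_integral gint) ht).
- move=> p q; rewrite -{1}(permKV u p) -{1}(permKV u q) => /conj_setE h.
  by apply: sub_gen_smallest; left.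
- by move=> a b c cb ba; apply: Ctr ba cb.
- exact: conj_perm_gt.
- by rewrite !conj_tableauE.
Qed.

End Conjugation.

(** * The extremal tableaux and the interval between them *)

Theorem theorem4p5 (R : realType) (n : nat) (g : 'rV[R]_n) (J : set 'rV[R]_n)
    (hshape : placed_shape g J) (hint : integral g)
    (hJ : forall b a : 'rV[R]_n,
        J b -> Zroots g a -> pos_roots R n (b - a) -> J (b - a)) :
  [/\ exists! wmin : 'S_n, column_reading g J wmin,
      exists! wmax : 'S_n, row_reading g J wmax &
      forall wmin wmax : 'S_n,
        column_reading g J wmin -> row_reading g J wmax ->
        [/\ tableaux g J wmin,
            tableaux g J wmax,
            inv_set R wmin = root_closure J,
            inv_set R wmax =
              pos_roots R n `\` root_closure ((Proots g `\` J) `|` Zroots g) &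
            tableaux g J = weak_interval R wmin wmax]].
Proof.
have [gdom JP] := hshape.
(* Two uses of [hJ], each subtracting a root of [Zroots g]: the first moves the upper end from [j]
   to [k], the second the lower end from [i] to [l]. *)
have Jst : nw_stable g J.
  move=> i j k l Jji gkj kj gli il.
  have /Proots_rt gji := JP _ Jji.
  have Jki : J (eps R k - eps R i).
    move: kj; rewrite leq_eqVlt => /predU1P[/val_inj->//|kj].
    have e : eps R k - eps R i = (eps R j - eps R i) - (eps R j - eps R k).
      by rewrite opprB [RHS]addrC subrKA.
    rewrite e; apply: hJ => //; first by apply/Zroots_rt.
    by rewrite -e; apply/pos_rt/(dominant_lt gdom); rewrite gkj gji ltrDl.
  move: il; rewrite leq_eqVlt => /predU1P[/val_inj<-//|il].
  have e : eps R k - eps R l = (eps R k - eps R i) - (eps R l - eps R i).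
    by rewrite opprB subrKA.
  rewrite e; apply: hJ => //; first by apply/Zroots_rt.
  by rewrite -e; apply/pos_rt/(dominant_lt gdom); rewrite gkj gji gli ltrDl.
split.
- have [t ht] := column_reading_exists gdom JP Jst.
  by exists t; split=> // t'; apply: column_reading_uniq.
- have [t ht] := column_reading_exists (conj_dominant gdom)
    (@conj_set_sub _ _ g J) (conj_nw_stable gdom Jst).
  (* The row reading is obtained by undoing conjugation on the column reading of the conjugate
     shape. *)
  have et : conj_tableau g (conj_perm g * t)%g = t.
    by rewrite /conj_tableau mulKg.
  exists (conj_perm g * t)%g; split.
    rewrite -et in ht; split=> //; apply/tableauxP => //.
    by apply: conj_standard => //; apply: column_reading_standard.
  move=> w [_ /(column_reading_uniq ht) ->].
  by rewrite /conj_tableau mulKVg.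
- move=> wmin wmax hmin [tmax hmax].
  have tmin : tableaux g J wmin by apply/tableauxP/column_reading_standard.
  have emin := column_reading_inv_set gdom JP Jst hint hmin.
  have emax := row_reading_inv_set gdom JP Jst hint hmax.
  split=> //; apply/seteqP; split=> w.
    move=> /tableauxP-/(_ gdom JP)/standard_closure_sub[] //.
    by rewrite -emin -emax.
  (* The inversion set is squeezed between those of [wmin] and [wmax]. These have the same
     intersection [J] with [Proots g], and the larger one avoids [Zroots g]. *)
  move=> [lew wle]; have [minZ minP] := tmin; have [maxZ maxP] := tmax.
  split.
    by rewrite -subset0 -maxZ; apply: setSI.
  apply/seteqP; split.
    by rewrite -[in X in _ `<=` X]maxP; apply: setSI.
  by rewrite -[in X in X `<=` _]minP; apply: setSI.
Qed.
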